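(* Let $\psi$ be a unit speed spacelike curve in $E_1^3$ with arclength parameter $s$, nowhere-zero curvature $\kappa$, and spacelike principal normal vector, which is a general helix whose tangent vector makes a constant Lorentzian timelike angle $\phi$ with a fixed timelike straight line (the axis). Put $n=\sinh\phi$ and $m=\frac{n}{\sqrt{1+n^2}}$. Then, up to an isometry of $E_1^3$ carrying the axis to the direction of $\mathbf{e}_1=(1,0,0)$, and for a suitable choice of the constants of integration, the position vector of $\psi$ is given in natural representation by $$\psi(s)=\sqrt{n^2+1}\int\Big(m,\ \cos\Big[\sqrt{1-m^2}\int\kappa(s)\,ds\Big],\ \sin\Big[\sqrt{1-m^2}\int\kappa(s)\,ds\Big]\Big)ds,$$ or, in parametric form with $\theta=\int\kappa(s)\,ds$, $$\psi(\theta)=\int\frac{\sqrt{n^2+1}}{\kappa(\theta)}\Big(m,\ \cos[\sqrt{1-m^2}\,\theta],\ \sin[\sqrt{1-m^2}\,\theta]\Big)d\theta.$$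
   Context: $E_1^3$ is $\mathbb{R}^3$ with the Lorentzian metric $g=-dx_1^2+dx_2^2+dx_3^2$ and $\|a\|=\sqrt{|g(a,a)|}$. A vector $v$ is spacelike if $g(v,v)>0$ or $v=0$, timelike if $g(v,v)<0$, and null if $g(v,v)=0$ and $v\neq0$. A curve is spacelike if all its velocity vectors are spacelike. All curves are smooth. For a unit speed spacelike curve with spacelike or timelike principal normal $N$, the Frenet frame $\{T=\psi',N,B\}$, curvature $\kappa$ and torsion $\tau$ satisfy $T'=\kappa N$, $N'=-\varepsilon\kappa T+\tau B$, $B'=\tau N$, where $g(T,T)=1$, $g(N,N)=\varepsilon=\pm1$, $g(B,B)=-\varepsilon$, and $T,N,B$ are mutually orthogonal (so $\varepsilon=1$ when $N$ is spacelike). A general helix is a curve whose tangent lines make a constant angle with a fixed direction. If $X$ is a spacelike vector and $Y$ a positive timelike vector, the Lorentzian timelike angle between them is the unique non-negative real number $\phi$ with $|g(X,Y)|=\|X\|\,\|Y\|\sinh\phi$. The angle between $T$ and a timelike line is the angle between $T$ and a positive direction vector of the line; thus here $n\ge0$ and $|g(T,\mathbf{d})|=n$ along the curve for a unit timelike direction vector $\mathbf{d}$ of the axis. *)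

(* Defs.v *)
From Stdlib Require Import Reals.
From Coquelicot Require Import Coquelicot.
Open Scope R_scope.

(** Minkowski 3-space: [R * R * R], i.e. triples [((x1, x2), x3)], with
    Coquelicot's product normed-module structure (used only for the topology and
    the vector space operations), and the metric [- dx1^2 + dx2^2 + dx3^2]. *)
Notation E13 := (R * R * R)%type.

Definition x1 (v : E13) : R := fst (fst v).
Definition x2 (v : E13) : R := snd (fst v).
Definition x3 (v : E13) : R := snd v.

Definition g (v w : E13) : R := - (x1 v * x1 w) + x2 v * x2 w + x3 v * x3 w.
Definition lnorm (v : E13) : R := sqrt (Rabs (g v v)).

Definition spacelike (v : E13) : Prop := 0 < g v v \/ v = (0, 0, 0).
Definition timelike (v : E13) : Prop := g v v < 0.
Definition positive_timelike (v : E13) : Prop := timelike v /\ 0 < x1 v.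

Definition e1 : E13 := (1, 0, 0).

Definition line (p d : E13) (x : E13) : Prop := exists t : R, x = plus p (scal t d).

Definition timelike_angle (X Y : E13) (phi : R) : Prop :=
  0 <= phi /\ Rabs (g X Y) = lnorm X * lnorm Y * sinh phi.

(** The isometries of a flat Lorentzian space are the affine maps whose linear
    part preserves [g]; invertibility follows from non-degeneracy of [g]. *)
Definition isometry (F : E13 -> E13) : Prop :=
  exists L : E13 -> E13,
    is_linear L /\
    (forall v w, g (L v) (L w) = g v w) /\
    (forall x, F x = plus (F (0, 0, 0)) (L x)).

Definition carries_line_to_direction
    (F : E13 -> E13) (p d e : E13) : Prop :=
  exists q : E13, forall y,
    (exists x, line p d x /\ F x = y) <-> line q e y.

(** Open, possibly unbounded, interval. *)
Definition in_itv (a b : Rbar) (s : R) : Prop := Rbar_lt a s /\ Rbar_lt s b.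

Definition smooth_curve (a b : Rbar) (psi : R -> E13) : Prop :=
  forall (k : nat) (s : R), in_itv a b s ->
    ex_derive_n (fun u => x1 (psi u)) k s /\
    ex_derive_n (fun u => x2 (psi u)) k s /\
    ex_derive_n (fun u => x3 (psi u)) k s.

Definition unit_speed_spacelike (a b : Rbar) (psi : R -> E13) : Prop :=
  forall s, in_itv a b s ->
    exists v : E13, is_derive psi s v /\ spacelike v /\ lnorm v = 1.

(** [kappa] is not required to be positive: the pair [(kappa, N)] may be replaced
    by [(- kappa, - N)] (with [tau] changed accordingly). *)
Record frenet_frame (a b : Rbar) (psi T N B : R -> E13) (kappa tau : R -> R)
    (eps : R) : Prop := {
  frenet_eps : eps = 1 \/ eps = -1;
  frenet_T : forall s, in_itv a b s -> is_derive psi s (T s);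
  frenet_gTT : forall s, in_itv a b s -> g (T s) (T s) = 1;
  frenet_gNN : forall s, in_itv a b s -> g (N s) (N s) = eps;
  frenet_gBB : forall s, in_itv a b s -> g (B s) (B s) = - eps;
  frenet_gTN : forall s, in_itv a b s -> g (T s) (N s) = 0;
  frenet_gTB : forall s, in_itv a b s -> g (T s) (B s) = 0;
  frenet_gNB : forall s, in_itv a b s -> g (N s) (B s) = 0;
  frenet_dT : forall s, in_itv a b s -> is_derive T s (scal (kappa s) (N s));
  frenet_dN : forall s, in_itv a b s ->
    is_derive N s (plus (scal (- eps * kappa s) (T s)) (scal (tau s) (B s)));
  frenet_dB : forall s, in_itv a b s -> is_derive B s (scal (tau s) (N s))
}.

(** [Phi] is an indefinite integral of [f] on the interval [(a, b)]; the constant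
    of integration is the freedom of adding a constant to [Phi]. *)
Definition indefinite_integral {V : NormedModule R_AbsRing}
    (a b : Rbar) (f Phi : R -> V) : Prop :=
  forall s0 s, in_itv a b s0 -> in_itv a b s ->
    is_RInt f s0 s (minus (Phi s) (Phi s0)).

(** [sigma] on [(c, d)] is the inverse of [theta] on [(a, b)]: it expresses the
    parameter [s] in terms of [theta]. *)
Definition inverse_parameter (a b c d : Rbar) (theta sigma : R -> R) : Prop :=
  (forall s, in_itv a b s -> in_itv c d (theta s) /\ sigma (theta s) = s) /\
  (forall t, in_itv c d t -> in_itv a b (sigma t) /\ theta (sigma t) = t).

Definition helix_direction (m t : R) : E13 :=
  (m, cos (sqrt (1 - m ^ 2) * t), sin (sqrt (1 - m ^ 2) * t)).

(* Main.v *)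
Require Import Defs.
From Stdlib Require Import Reals Lra Ranalysis5.
From Coquelicot Require Import Coquelicot.
Open Scope R_scope.

(** The proof writes the tangent in a Lorentz frame built from the axis and
    recognises a uniform rotation.

    Since [|g (T, d)|] is constant, so is [g (T, d)]; differentiating gives
    [kappa g (N, d) = 0], hence [g (N, d) = 0] ([helix_axis]). Scale [d] to a unit
    timelike vector [A] with [g (T, A) = - n], reversing it if needed; put
    [r = sqrt (1 + n^2)], fix a base point [s0], and let [E] be the unit vector
    along the component of [T s0] orthogonal to [A]. Then [A], [E], [N s0] is a
    Lorentz frame ([tangent_lorentz_frame]), and taking coordinates in it is a linear
    isometry [L] that sends [A] to [e1] ([g_frame_coordinates]).

    In these coordinates [T] is [(n, u, v)] with [u^2 + v^2 = r^2], and [N] is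
    [(0, p, q)] with [(p, q)] a unit vector orthogonal to [(u, v)], so
    [(p, q) = (- v, u) / r]: the sign is fixed at [s0], where
    [(u, v) = (r, 0)] and [(p, q) = (0, 1)]. The equation [T' = kappa N] then says
    that [(u, v)] rotates with angular velocity [kappa / r] ([circle_motion]). With
    [theta] the antiderivative of [kappa] vanishing at [s0], this reads
    [L T = r (m, cos (theta / r), sin (theta / r))], where
    [1 / r = sqrt (1 - m^2)]; integrating it gives the natural representation.

    For the parametric form, [kappa] is continuous because the curve is smooth
    ([frenet_curvature_continuous]); being nowhere zero it has a constant sign, so
    [theta] is a diffeomorphism onto an open interval
    ([differentiable_inverse_parameter]), and the chain rule applies to
    [psi (sigma t)]. *)

(** * Calculus on an open interval *)

Lemma in_itv_between (a b : Rbar) (s t u : R) :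
  in_itv a b s -> in_itv a b t -> Rmin s t <= u <= Rmax s t -> in_itv a b u.
Proof.
  intros [Hs1 Hs2] [Ht1 Ht2] [Hu1 Hu2].
  split.
  - apply Rbar_lt_le_trans with (Finite (Rmin s t)); [| exact Hu1].
    unfold Rmin; destruct (Rle_dec s t); assumption.
  - apply Rbar_le_lt_trans with (Finite (Rmax s t)); [exact Hu2 |].
    unfold Rmax; destruct (Rle_dec s t); assumption.
Qed.

Lemma in_itv_locally (a b : Rbar) (s : R) :
  in_itv a b s -> locally s (in_itv a b).
Proof.
  intros [H1 H2].
  destruct (Rbar_lt_locally a b s H1 H2) as [delta Hdelta].
  exists delta; intros u Hu; exact (Hdelta u Hu).
Qed.

Lemma in_itv_inhabited (a b : Rbar) : Rbar_lt a b -> exists s, in_itv a b s.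
Proof.
  unfold in_itv.
  destruct a as [a | |], b as [b | |]; simpl; intro H; try contradiction.
  - exists ((a + b) / 2); simpl; lra.
  - exists (a + 1); simpl; split; [lra | exact I].
  - exists (b - 1); simpl; split; [exact I | lra].
  - exists 0; split; exact I.
Qed.

Lemma derive_zero_constant (a b : Rbar) (f : R -> R) :
  (forall s, in_itv a b s -> is_derive f s 0) ->
  forall s t, in_itv a b s -> in_itv a b t -> f s = f t.
Proof.
  intros Hf.
  assert (lt_case : forall s t, in_itv a b s -> in_itv a b t -> s < t -> f s = f t).
  { intros s t Hs Ht Hst.
    apply eq_is_derive; [| exact Hst].
    intros u Hu; apply Hf, (in_itv_between a b s t); auto.
    rewrite Rmin_left, Rmax_right; lra. }
  intros s t Hs Ht.
  destruct (Rtotal_order s t) as [H | [H | H]].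
  - auto.
  - now subst.
  - symmetry; auto.
Qed.

(** Differentiating [f ^ 2 = c] gives [f f' = 0], which settles the points where
    [f] does not vanish; where it does, [c = 0] and [f] is identically zero.
    This is how a quantity known up to sign is shown to keep its sign. *)
Lemma derive_zero_of_constant_square (a b : Rbar) (f df : R -> R) (c : R) :
  (forall s, in_itv a b s -> is_derive f s (df s)) ->
  (forall s, in_itv a b s -> f s * f s = c) ->
  forall s, in_itv a b s -> df s = 0.
Proof.
  intros Hdf Hsq s Hs.
  destruct (Req_dec (f s) 0) as [Hf0 | Hf0].
  - assert (Hc : c = 0) by (rewrite <- (Hsq s Hs), Hf0; ring).
    rewrite <- (is_derive_unique _ _ _ (Hdf s Hs)).
    apply is_derive_unique.
    apply (is_derive_ext_loc (fun _ => 0)).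
    + apply filter_imp with (2 := in_itv_locally a b s Hs).
      intros u Hu; symmetry.
      pose proof (Hsq u Hu) as H; rewrite Hc in H.
      destruct (Rmult_integral _ _ H); assumption.
    + exact (is_derive_const 0 s).
  - assert (H1 : is_derive (fun u => f u * f u) s (df s * f s + f s * df s)).
    { exact (is_derive_mult f f s _ _ (Hdf s Hs) (Hdf s Hs) Rmult_comm). }
    assert (H2 : is_derive (fun u => f u * f u) s 0).
    { apply (is_derive_ext_loc (fun _ => c)).
      - apply filter_imp with (2 := in_itv_locally a b s Hs).
        intros u Hu; symmetry; auto.
      - exact (is_derive_const c s). }
    apply is_derive_unique in H1; apply is_derive_unique in H2.
    rewrite H1 in H2.
    apply (Rmult_eq_reg_l (f s)); [lra | exact Hf0].
Qed.

(** The derivatives of [f] supplied by hypothesis agree with the total operators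
    [Derive_n] only on the interval, which suffices because it is open. *)
Lemma continuous_second_derivative (a b : Rbar) (f f' f'' : R -> R) :
  (forall s, in_itv a b s -> ex_derive_n f 3 s) ->
  (forall s, in_itv a b s -> is_derive f s (f' s)) ->
  (forall s, in_itv a b s -> is_derive f' s (f'' s)) ->
  forall s, in_itv a b s -> continuous f'' s.
Proof.
  intros H3 H1 H2 s Hs.
  apply (continuous_ext_loc _ (Derive_n f 2)).
  - apply filter_imp with (2 := in_itv_locally a b s Hs).
    intros u Hu; simpl.
    rewrite (Derive_ext_loc (Derive f) f').
    + apply is_derive_unique; auto.
    + apply filter_imp with (2 := in_itv_locally a b u Hu).
      intros w Hw; apply is_derive_unique; auto.
  - apply (ex_derive_continuous (V := R_NormedModule)), (H3 s Hs).
Qed.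

Lemma antiderivative_vanishing_at (a b : Rbar) (f : R -> R) (s0 : R) :
  in_itv a b s0 -> (forall s, in_itv a b s -> continuous f s) ->
  exists F : R -> R, F s0 = 0 /\ forall s, in_itv a b s -> is_derive F s (f s).
Proof.
  intros Hs0 Hf.
  exists (fun s => RInt f s0 s); split.
  - apply (RInt_point (V := R_CompleteNormedModule)).
  - intros s Hs.
    apply (is_derive_RInt f _ s0); [| auto].
    apply filter_imp with (2 := in_itv_locally a b s Hs).
    intros u Hu.
    apply (RInt_correct (V := R_CompleteNormedModule)), ex_RInt_continuous.
    intros w Hw; apply Hf, (in_itv_between a b s0 u); auto.
Qed.

Lemma indefinite_integral_of_derive (a b : Rbar) (f F : R -> R) :
  (forall s, in_itv a b s -> is_derive F s (f s)) ->
  (forall s, in_itv a b s -> continuous f s) ->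
  indefinite_integral a b f F.
Proof.
  intros HF Hf s0 s Hs0 Hs.
  apply (is_RInt_derive (V := R_CompleteNormedModule)); intros u Hu.
  - apply HF, (in_itv_between a b s0 s); auto.
  - apply Hf, (in_itv_between a b s0 s); auto.
Qed.

Lemma attained_between (a b : Rbar) (f : R -> R) (s t y : R) :
  (forall u, in_itv a b u -> continuous f u) ->
  in_itv a b s -> in_itv a b t -> s < t -> f s < y < f t ->
  exists u, s <= u <= t /\ f u = y.
Proof.
  intros Hf Hs Ht Hst Hy.
  destruct (IVT_interv (fun u => f u - y) s t) as [u [Hu1 Hu2]].
  - intros u Hu.
    apply continuity_pt_minus.
    + apply continuity_pt_filterlim, Hf, (in_itv_between a b s t); auto.
      rewrite Rmin_left, Rmax_right; lra.
    + apply continuity_pt_const; intros v w; reflexivity.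
  - exact Hst.
  - lra.
  - lra.
  - exists u; split; [exact Hu1 | lra].
Qed.

Lemma continuous_nonvanishing_sign (a b : Rbar) (f : R -> R) (s0 : R) :
  in_itv a b s0 ->
  (forall s, in_itv a b s -> continuous f s) ->
  (forall s, in_itv a b s -> f s <> 0) ->
  (forall s, in_itv a b s -> 0 < f s) \/ (forall s, in_itv a b s -> f s < 0).
Proof.
  intros Hs0 Hf Hnz.
  assert (Hopp : forall u, in_itv a b u -> continuous (fun x => - f x) u).
  { intros u Hu; apply (continuous_opp (V := R_NormedModule)); auto. }
  assert (no_change : forall s t, in_itv a b s -> in_itv a b t ->
            f s < 0 -> 0 < f t -> False).
  { intros s t Hs Ht Hfs Hft.
    destruct (Rtotal_order s t) as [H | [H | H]].
    - destruct (attained_between a b f s t 0) as [u [Hu1 Hu2]]; auto.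
      apply (Hnz u); auto.
      apply (in_itv_between a b s t); auto.
      rewrite Rmin_left, Rmax_right; lra.
    - subst; lra.
    - destruct (attained_between a b (fun x => - f x) t s 0) as [u [Hu1 Hu2]];
        auto; [lra |].
      apply (Hnz u); [| lra].
      apply (in_itv_between a b s t); auto.
      rewrite Rmin_right, Rmax_left; lra. }
  destruct (Rtotal_order (f s0) 0) as [H | [H | H]].
  - right; intros s Hs.
    destruct (Rtotal_order (f s) 0) as [H' | [H' | H']]; auto.
    + now elim (Hnz s Hs).
    + elim (no_change s0 s); auto.
  - now elim (Hnz s0 Hs0).
  - left; intros s Hs.
    destruct (Rtotal_order (f s) 0) as [H' | [H' | H']]; auto.
    + elim (no_change s s0); auto.
    + now elim (Hnz s Hs).
Qed.

(** * Inverting a parameter with nowhere-zero derivative *)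

(** The new interval is bounded by the infimum and the supremum of the values:
    strict monotonicity on an open interval keeps both from being attained, and
    the intermediate value theorem fills the space between them. *)
Lemma increasing_inverse_parameter (a b : Rbar) (theta k : R -> R) :
  (forall s, in_itv a b s -> is_derive theta s (k s)) ->
  (forall s, in_itv a b s -> 0 < k s) ->
  exists (c c' : Rbar) (sigma : R -> R),
    inverse_parameter a b c c' theta sigma /\
    forall t, in_itv c c' t -> continuous sigma t.
Proof.
  intros Hd Hpos.
  assert (Hc : forall s, in_itv a b s -> continuous theta s).
  { intros s Hs; apply (ex_derive_continuous (V := R_NormedModule)).
    exists (k s); auto. }
  assert (Hinc : forall s t, in_itv a b s -> in_itv a b t -> s < t ->
            theta s < theta t).
  { intros s t Hs Ht Hst.
    apply (incr_function theta a b k); try apply Hs; try apply Ht; auto.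
    - intros u H1 H2; apply Hd; split; assumption.
    - intros u H1 H2; apply Hpos; split; assumption. }
  assert (Hinj : forall s t, in_itv a b s -> in_itv a b t ->
            theta s = theta t -> s = t).
  { intros s t Hs Ht Hst.
    destruct (Rtotal_order s t) as [H | [H | H]]; auto.
    - pose proof (Hinc s t Hs Ht H); lra.
    - pose proof (Hinc t s Ht Hs H); lra. }
  assert (Hnbr : forall s (eps : posreal), in_itv a b s -> exists e, 0 < e < eps /\
            in_itv a b (s - e) /\ in_itv a b (s + e)).
  { intros s eps Hs.
    destruct (in_itv_locally a b s Hs) as [delta Hdelta].
    exists (Rmin delta eps / 2).
    pose proof (cond_pos delta); pose proof (cond_pos eps).
    assert (0 < Rmin delta eps) by (apply Rmin_glb_lt; assumption).
    pose proof (Rmin_l delta eps); pose proof (Rmin_r delta eps).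
    split; [lra |].
    split; apply Hdelta; unfold ball; simpl; unfold AbsRing_ball, abs, minus, plus, opp;
      simpl; apply Rabs_def1; lra. }
  set (image := fun t => exists s, in_itv a b s /\ theta s = t).
  set (c := Glb_Rbar image); set (c' := Lub_Rbar image).
  destruct (Glb_Rbar_correct image) as [Hglb1 Hglb2].
  destruct (Lub_Rbar_correct image) as [Hlub1 Hlub2].
  fold c in Hglb1, Hglb2; fold c' in Hlub1, Hlub2.
  assert (Hin : forall s, in_itv a b s -> in_itv c c' (theta s)).
  { intros s Hs.
    destruct (Hnbr s (mkposreal 1 Rlt_0_1) Hs) as [e [He [Hl Hr]]].
    split.
    - apply Rbar_le_lt_trans with (Finite (theta (s - e))).
      + apply Hglb1; exists (s - e); auto.
      + apply Hinc; auto; lra.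
    - apply Rbar_lt_le_trans with (Finite (theta (s + e))).
      + apply Hinc; auto; lra.
      + apply Hlub1; exists (s + e); auto. }
  assert (Hsurj : forall t, in_itv c c' t -> exists s, in_itv a b s /\ theta s = t).
  { intros t [Ht1 Ht2].
    assert (Hlow : exists s, in_itv a b s /\ theta s < t).
    { apply Classical_Prop.NNPP; intro Hno.
      apply (Rbar_lt_not_le _ _ Ht1), Hglb2.
      intros y [s [Hs Hy]]; simpl.
      apply Rnot_lt_le; intro Hlt; apply Hno; exists s; subst; auto. }
    assert (Hhigh : exists s, in_itv a b s /\ t < theta s).
    { apply Classical_Prop.NNPP; intro Hno.
      apply (Rbar_lt_not_le _ _ Ht2), Hlub2.
      intros y [s [Hs Hy]]; simpl.
      apply Rnot_lt_le; intro Hlt; apply Hno; exists s; subst; auto. }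
    destruct Hlow as [s1 [Hs1 Hs1t]]; destruct Hhigh as [s2 [Hs2 Hs2t]].
    assert (Hlt : s1 < s2).
    { apply Rnot_le_lt; intros [H | H].
      - pose proof (Hinc s2 s1 Hs2 Hs1 H); lra.
      - subst; lra. }
    destruct (attained_between a b theta s1 s2 t) as [u [Hu1 Hu2]]; auto.
    exists u; split; auto.
    apply (in_itv_between a b s1 s2); auto.
    rewrite Rmin_left, Rmax_right; lra. }
  (* Injectivity makes the preimage unique, so [iota] returns it. *)
  set (sigma := fun t => iota (fun s => in_itv a b s /\ theta s = t)).
  assert (Hsigma : forall t, in_itv c c' t ->
            in_itv a b (sigma t) /\ theta (sigma t) = t).
  { intros t Ht.
    apply (iota_correct (fun s => in_itv a b s /\ theta s = t)).
    destruct (Hsurj t Ht) as [s [Hs Hst]].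
    exists s; split; [auto |].
    intros s' [Hs' Hs't]; apply Hinj; auto; lra. }
  exists c, c', sigma; split; [split |].
  - intros s Hs; split; [auto |].
    destruct (Hsigma (theta s) (Hin s Hs)); auto.
  - exact Hsigma.
  - intros t Ht.
    destruct (Hsigma t Ht) as [Hs Hst].
    apply filterlim_locally; intros eps.
    (* The values of [theta] at [sigma t - e] and [sigma t + e] bound a
       neighbourhood of [t] that [sigma] maps within [e] of [sigma t]. *)
    destruct (Hnbr (sigma t) eps Hs) as [e [He [Hl Hr]]].
    assert (H1 : theta (sigma t - e) < t) by (rewrite <- Hst at 2; apply Hinc; auto; lra).
    assert (H2 : t < theta (sigma t + e)) by (rewrite <- Hst at 1; apply Hinc; auto; lra).
    assert (Hloc : locally t (fun u =>
              in_itv (theta (sigma t - e)) (theta (sigma t + e)) u)).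
    { apply in_itv_locally; split; assumption. }
    generalize (filter_and _ _ Hloc (in_itv_locally c c' t Ht)).
    apply filter_imp.
    intros u [[Hu1 Hu2] Hu]; simpl in Hu1, Hu2.
    destruct (Hsigma u Hu) as [Hsu Htu].
    assert (Hlow : sigma t - e < sigma u).
    { apply Rnot_le_lt; intros [H | H].
      - pose proof (Hinc _ _ Hsu Hl H); lra.
      - rewrite H in Htu; lra. }
    assert (Hhigh : sigma u < sigma t + e).
    { apply Rnot_le_lt; intros [H | H].
      - pose proof (Hinc _ _ Hr Hsu H); lra.
      - rewrite <- H in Htu; lra. }
    unfold ball; simpl; unfold AbsRing_ball, abs, minus, plus, opp; simpl.
    apply Rabs_def1; lra.
Qed.

(** By the mean value theorem a difference quotient of [sigma] at [t] is
    [1 / k xi] with [xi] between [sigma t] and the neighbouring value; continuity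
    of [sigma] drives [xi] to [sigma t]. *)
Lemma is_derive_inverse_parameter (a b c c' : Rbar) (theta sigma k : R -> R) :
  inverse_parameter a b c c' theta sigma ->
  (forall s, in_itv a b s -> is_derive theta s (k s)) ->
  (forall s, in_itv a b s -> continuous k s) ->
  (forall s, in_itv a b s -> k s <> 0) ->
  forall t, in_itv c c' t -> continuous sigma t -> is_derive sigma t (/ k (sigma t)).
Proof.
  intros [_ Hinv] Hd Hk Hnz t Ht Hcont.
  destruct (Hinv t Ht) as [Hs Hst].
  assert (Hkinv : continuous (fun s => / k s) (sigma t)).
  { apply continuity_pt_filterlim, continuity_pt_inv; [| auto].
    apply continuity_pt_filterlim, Hk; auto. }
  apply is_derive_Reals; intros eps Heps.
  destruct (proj1 (filterlim_locally _ _) Hkinv (mkposreal eps Heps)) as [d1 Hd1].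
  pose proof (proj1 (filterlim_locally _ _) Hcont d1) as Hclose.
  destruct (filter_and _ _ Hclose (in_itv_locally c c' t Ht)) as [d2 Hd2].
  exists d2; intros h Hh0 Hh.
  destruct (Hd2 (t + h)) as [Hball Hth].
  { unfold ball; simpl; unfold AbsRing_ball, abs, minus, plus, opp; simpl.
    replace (t + h + - t) with h by ring; exact Hh. }
  destruct (Hinv _ Hth) as [Hs' Hs't].
  destruct (MVT_gen theta (sigma t) (sigma (t + h)) k) as [xi [Hxi Hmvt]].
  { intros u Hu; apply Hd, (in_itv_between a b (sigma t) (sigma (t + h))); auto; lra. }
  { intros u Hu; apply continuity_pt_filterlim.
    apply (ex_derive_continuous (V := R_NormedModule)).
    exists (k u); apply Hd, (in_itv_between a b (sigma t) (sigma (t + h))); auto. }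
  rewrite Hst, Hs't in Hmvt.
  assert (Hkxi : k xi <> 0).
  { apply Hnz, (in_itv_between a b (sigma t) (sigma (t + h))); auto. }
  replace ((sigma (t + h) - sigma t) / h) with (/ k xi).
  - apply (Hd1 xi).
    unfold ball in *; simpl in *; unfold AbsRing_ball, abs, minus, plus, opp in *;
      simpl in *.
    apply Rabs_def2 in Hball.
    apply Rabs_def1; revert Hxi; unfold Rmin, Rmax;
      destruct (Rle_dec (sigma t) (sigma (t + h))); lra.
  - apply (Rmult_eq_reg_l (k xi * h)).
    + replace (k xi * h * / k xi) with h by (field; auto).
      replace (k xi * h * ((sigma (t + h) - sigma t) / h))
        with (k xi * (sigma (t + h) - sigma t)) by (field; auto).
      lra.
    + now apply Rmult_integral_contrapositive.
Qed.

Lemma in_itv_opp (a b : Rbar) (t : R) :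
  in_itv (Rbar_opp b) (Rbar_opp a) t <-> in_itv a b (- t).
Proof.
  unfold in_itv.
  change (Finite (- t)) with (Rbar_opp (Finite t)).
  rewrite <- (Rbar_opp_lt (Rbar_opp t) a), <- (Rbar_opp_lt b (Rbar_opp t)).
  rewrite Rbar_opp_involutive; tauto.
Qed.

Lemma differentiable_inverse_parameter (a b : Rbar) (theta k : R -> R) :
  Rbar_lt a b ->
  (forall s, in_itv a b s -> is_derive theta s (k s)) ->
  (forall s, in_itv a b s -> continuous k s) ->
  (forall s, in_itv a b s -> k s <> 0) ->
  exists (c c' : Rbar) (sigma : R -> R),
    inverse_parameter a b c c' theta sigma /\
    forall t, in_itv c c' t -> is_derive sigma t (/ k (sigma t)).
Proof.
  intros Hab Hd Hk Hnz.
  destruct (in_itv_inhabited a b Hab) as [s0 Hs0].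
  assert (exists (c c' : Rbar) (sigma : R -> R),
            inverse_parameter a b c c' theta sigma /\
            forall t, in_itv c c' t -> continuous sigma t)
    as (c & c' & sigma & Hinv & Hcont).
  { destruct (continuous_nonvanishing_sign a b k s0 Hs0 Hk Hnz) as [Hpos | Hneg].
    - exact (increasing_inverse_parameter a b theta k Hd Hpos).
    - (* If [theta] decreases, invert [- theta] and reflect its interval of values. *)
      destruct (increasing_inverse_parameter a b (fun s => - theta s) (fun s => - k s))
        as (c & c' & sigma & [Hinv1 Hinv2] & Hcont).
      + intros s Hs; apply (is_derive_opp theta s (k s)); auto.
      + intros s Hs; pose proof (Hneg s Hs); lra.
      + exists (Rbar_opp c'), (Rbar_opp c), (fun t => sigma (- t)).
        split; [split |].
        * intros s Hs; destruct (Hinv1 s Hs); split; auto.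
          now apply in_itv_opp.
        * intros t Ht; apply in_itv_opp in Ht.
          destruct (Hinv2 _ Ht); split; auto; lra.
        * intros t Ht; apply in_itv_opp in Ht.
          apply (continuous_comp (fun t => - t) sigma); [| auto].
          apply (continuous_opp (V := R_NormedModule)), continuous_id. }
  exists c, c', sigma; split; [exact Hinv |].
  intros t Ht.
  apply (is_derive_inverse_parameter a b c c' theta); auto.
Qed.

(** * Lorentzian frames and isometries *)

Lemma is_linear_x1 : is_linear x1.
Proof. exact (is_linear_comp fst fst is_linear_fst is_linear_fst). Qed.

Lemma is_linear_x2 : is_linear x2.
Proof. exact (is_linear_comp fst snd is_linear_fst is_linear_snd). Qed.

Lemma is_linear_x3 : is_linear x3.
Proof. exact is_linear_snd. Qed.

Lemma is_linear_combination (l1 l2 : E13 -> R) (c1 c2 : R) :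
  is_linear l1 -> is_linear l2 -> is_linear (fun v => c1 * l1 v + c2 * l2 v).
Proof.
  intros H1 H2.
  apply (is_linear_comp (fun v => (c1 * l1 v, c2 * l2 v)) (fun w => plus (fst w) (snd w)));
    [| apply is_linear_plus].
  apply (is_linear_prod (fun v => c1 * l1 v) (fun v => c2 * l2 v)).
  - exact (is_linear_comp l1 _ H1
             (is_linear_scal_r (V := R_NormedModule) c1 Rmult_comm)).
  - exact (is_linear_comp l2 _ H2
             (is_linear_scal_r (V := R_NormedModule) c2 Rmult_comm)).
Qed.

Lemma is_linear_g (w : E13) : is_linear (fun v => g v w).
Proof.
  assert (H : forall v,
            1 * (- x1 w * x1 v + x2 w * x2 v) + x3 w * x3 v = g v w)
    by (intro v; unfold g; ring).
  apply (is_linear_ext _ _ H).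
  apply is_linear_combination; [| exact is_linear_x3].
  apply is_linear_combination; [exact is_linear_x1 | exact is_linear_x2].
Qed.

Lemma g_sym (v w : E13) : g v w = g w v.
Proof. unfold g; ring. Qed.

Lemma g_scal (c : R) (v w : E13) : g (scal c v) w = c * g v w.
Proof. exact (linear_scal _ (is_linear_g w) c v). Qed.

Lemma g_plus (u v w : E13) : g (plus u v) w = g u w + g v w.
Proof. exact (linear_plus _ (is_linear_g w) u v). Qed.

Record lorentz_frame (A E M : E13) : Prop := {
  frame_AA : g A A = -1;
  frame_EE : g E E = 1;
  frame_MM : g M M = 1;
  frame_AE : g A E = 0;
  frame_AM : g A M = 0;
  frame_EM : g E M = 0
}.

(** The square of the determinant of a frame is minus its Gram determinant, so
    Cramer's rule kills every vector orthogonal to the three frame vectors. *)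
Lemma lorentz_frame_nondegenerate (A E M u : E13) :
  lorentz_frame A E M -> g u A = 0 -> g u E = 0 -> g u M = 0 -> u = (0, 0, 0).
Proof.
  intros [HAA HEE HMM HAE HAM HEM] HA HE HM.
  destruct A as [[A1 A2] A3], E as [[E1 E2] E3], M as [[M1 M2] M3], u as [[u1 u2] u3].
  unfold g, x1, x2, x3 in *; simpl in *.
  set (det := A1 * (E2 * M3 - E3 * M2) - A2 * (E1 * M3 - E3 * M1)
              + A3 * (E1 * M2 - E2 * M1)).
  assert (Hdet : det * det = 1).
  { transitivity (- ((- (A1 * A1) + A2 * A2 + A3 * A3)
        * ((- (E1 * E1) + E2 * E2 + E3 * E3) * (- (M1 * M1) + M2 * M2 + M3 * M3)
           - (- (E1 * M1) + E2 * M2 + E3 * M3) * (- (E1 * M1) + E2 * M2 + E3 * M3))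
      - (- (A1 * E1) + A2 * E2 + A3 * E3)
        * ((- (A1 * E1) + A2 * E2 + A3 * E3) * (- (M1 * M1) + M2 * M2 + M3 * M3)
           - (- (E1 * M1) + E2 * M2 + E3 * M3) * (- (A1 * M1) + A2 * M2 + A3 * M3))
      + (- (A1 * M1) + A2 * M2 + A3 * M3)
        * ((- (A1 * E1) + A2 * E2 + A3 * E3) * (- (E1 * M1) + E2 * M2 + E3 * M3)
           - (- (E1 * E1) + E2 * E2 + E3 * E3) * (- (A1 * M1) + A2 * M2 + A3 * M3)))).
    - unfold det; ring.
    - rewrite HAA, HEE, HMM, HAE, HAM, HEM; ring. }
  assert (Hdet0 : det <> 0) by (intro H; rewrite H in Hdet; lra).
  assert (H1 : det * u1 = 0).
  { transitivity (- ((- (u1 * A1) + u2 * A2 + u3 * A3) * (E2 * M3 - E3 * M2)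
      - (- (u1 * E1) + u2 * E2 + u3 * E3) * (A2 * M3 - A3 * M2)
      + (- (u1 * M1) + u2 * M2 + u3 * M3) * (A2 * E3 - A3 * E2))).
    - unfold det; ring.
    - rewrite HA, HE, HM; ring. }
  assert (H2 : det * u2 = 0).
  { transitivity (- ((- (u1 * A1) + u2 * A2 + u3 * A3) * (E1 * M3 - E3 * M1)
      - (- (u1 * E1) + u2 * E2 + u3 * E3) * (A1 * M3 - A3 * M1)
      + (- (u1 * M1) + u2 * M2 + u3 * M3) * (A1 * E3 - A3 * E1))).
    - unfold det; ring.
    - rewrite HA, HE, HM; ring. }
  assert (H3 : det * u3 = 0).
  { transitivity ((- (u1 * A1) + u2 * A2 + u3 * A3) * (E1 * M2 - E2 * M1)
      - (- (u1 * E1) + u2 * E2 + u3 * E3) * (A1 * M2 - A2 * M1)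
      + (- (u1 * M1) + u2 * M2 + u3 * M3) * (A1 * E2 - A2 * E1)).
    - unfold det; ring.
    - rewrite HA, HE, HM; ring. }
  destruct (Rmult_integral _ _ H1); [contradiction |].
  destruct (Rmult_integral _ _ H2); [contradiction |].
  destruct (Rmult_integral _ _ H3); [contradiction |].
  now subst.
Qed.

Lemma lorentz_frame_expansion (A E M v : E13) :
  lorentz_frame A E M ->
  v = plus (scal (- g v A) A) (plus (scal (g v E) E) (scal (g v M) M)).
Proof.
  intros HF.
  set (w := plus (scal (- g v A) A) (plus (scal (g v E) E) (scal (g v M) M)) : E13).
  assert (Hw : plus v (scal (-1) w) = (0, 0, 0)).
  { destruct HF as [HAA HEE HMM HAE HAM HEM].
    apply (lorentz_frame_nondegenerate A E M);
      [split; assumption | | |]; unfold w; rewrite !g_plus, !g_scal, !g_plus, !g_scal;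
      rewrite ?(g_sym M E), ?(g_sym M A), ?(g_sym E A), ?HAA, ?HEE, ?HMM, ?HAE, ?HAM, ?HEM;
      ring. }
  change (v = w).
  clearbody w; destruct v as [[v1 v2] v3], w as [[w1 w2] w3].
  change ((v1 + -1 * w1, v2 + -1 * w2, v3 + -1 * w3) = (0, 0, 0)) in Hw.
  injection Hw; intros; repeat f_equal; lra.
Qed.

(** The minus sign comes from [g A A = -1]: it makes these the coefficients of
    [lorentz_frame_expansion]. *)
Definition frame_coordinates (A E M v : E13) : E13 := (- g v A, g v E, g v M).

Lemma is_linear_frame_coordinates (A E M : E13) : is_linear (frame_coordinates A E M).
Proof.
  apply (is_linear_prod (fun v => (- g v A, g v E)) (fun v => g v M));
    [| apply is_linear_g].
  apply (is_linear_prod (fun v => - g v A) (fun v => g v E)); [| apply is_linear_g].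
  apply (is_linear_comp (fun v => g v A) opp); [apply is_linear_g | apply is_linear_opp].
Qed.

(** Parseval's identity for the frame. *)
Lemma g_frame_coordinates (A E M v w : E13) :
  lorentz_frame A E M ->
  g (frame_coordinates A E M v) (frame_coordinates A E M w) = g v w.
Proof.
  intros HF.
  rewrite (lorentz_frame_expansion A E M v HF) at 2.
  rewrite !g_plus, !g_scal, (g_sym A), (g_sym E), (g_sym M).
  unfold g at 1, frame_coordinates, x1, x2, x3; simpl; ring.
Qed.

Lemma isometry_of_linear (L : E13 -> E13) :
  is_linear L -> (forall v w, g (L v) (L w) = g v w) -> isometry L.
Proof.
  intros HL Hg; exists L; split; [exact HL | split; [exact Hg |]].
  intro x.
  replace (L (0, 0, 0)) with (zero : E13) by (symmetry; apply (linear_zero L HL)).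
  symmetry; apply (plus_zero_l (L x)).
Qed.

Lemma linear_carries_line_to_direction (L : E13 -> E13) (p d e : E13) (k : R) :
  is_linear L -> k <> 0 -> L (scal k d) = e -> carries_line_to_direction L p d e.
Proof.
  intros HL Hk He; exists (L p); intro y; split.
  (* [L d = e / k], so the parameter on the line is divided by [k]. *)
  - intros [x [[t Hx] Hy]]; exists (t / k).
    rewrite <- Hy, Hx, (linear_plus L HL), <- He, !(linear_scal L HL), scal_assoc.
    f_equal; f_equal; unfold mult; simpl; field; exact Hk.
  - intros [t Hy]; exists (plus p (scal (t * k) d)); split.
    + exists (t * k); reflexivity.
    + rewrite Hy, (linear_plus L HL), <- He, !(linear_scal L HL), scal_assoc.
      reflexivity.
Qed.

(** * Derivatives and integrals of curves *)

Lemma is_derive_linear {U V : NormedModule R_AbsRing} (L : U -> V) (f : R -> U)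
    (s : R) (df : U) :
  is_linear L -> is_derive f s df -> is_derive (fun u => L (f u)) s (L df).
Proof.
  intros HL Hf.
  apply (filterdiff_ext_lin (U := R_NormedModule) _ (fun h : R => L (scal h df))).
  - apply (filterdiff_comp' f L s _ L); [exact Hf | now apply filterdiff_linear].
  - intro h; exact (linear_scal L HL h df).
Qed.

Lemma continuous_linear_of_is_derive {U V : NormedModule R_AbsRing} (L : U -> V)
    (f : R -> U) (s : R) (df : U) :
  is_linear L -> is_derive f s df -> continuous (fun u => L (f u)) s.
Proof.
  intros HL Hf; apply (ex_derive_continuous (V := V)).
  exists (L df); exact (is_derive_linear L f s df HL Hf).
Qed.

Lemma indefinite_integral_curve_of_derive (a b : Rbar) (f F : R -> E13) :
  (forall s, in_itv a b s -> is_derive F s (f s)) ->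
  (forall s, in_itv a b s -> continuous f s) ->
  indefinite_integral a b f F.
Proof.
  intros HF Hf.
  assert (coordinate : forall l : E13 -> R, is_linear l ->
            indefinite_integral a b (fun s => l (f s)) (fun s => l (F s))).
  { intros l Hl; apply indefinite_integral_of_derive; intros s Hs.
    - apply is_derive_linear; auto.
    - apply (continuous_comp f l); [auto | exact (linear_cont l (f s) Hl)]. }
  intros s0 s Hs0 Hs.
  apply (is_RInt_fct_extend_pair f s0 s (minus (x1 (F s)) (x1 (F s0)),
           minus (x2 (F s)) (x2 (F s0))) (minus (x3 (F s)) (x3 (F s0)))).
  - apply (is_RInt_fct_extend_pair (fun t => fst (f t))).
    + exact (coordinate x1 is_linear_x1 s0 s Hs0 Hs).
    + exact (coordinate x2 is_linear_x2 s0 s Hs0 Hs).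
  - exact (coordinate x3 is_linear_x3 s0 s Hs0 Hs).
Qed.

Lemma indefinite_integral_ext {V : NormedModule R_AbsRing} (a b : Rbar) (f h F : R -> V) :
  (forall s, in_itv a b s -> f s = h s) ->
  indefinite_integral a b f F -> indefinite_integral a b h F.
Proof.
  intros Hfh Hf s0 s Hs0 Hs.
  apply (is_RInt_ext f); [| auto].
  intros u Hu; apply Hfh, (in_itv_between a b s0 s); auto; lra.
Qed.

(** * Plane motion along a circle *)

(** Rotating [(u, v)] back by the angle [w * theta] gives a vector with zero
    derivative. *)
Lemma rotation_solution (a b : Rbar) (theta k u v : R -> R) (w r s0 : R) :
  in_itv a b s0 ->
  (forall s, in_itv a b s -> is_derive theta s (k s)) ->
  (forall s, in_itv a b s -> is_derive u s (- (w * k s * v s))) ->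
  (forall s, in_itv a b s -> is_derive v s (w * k s * u s)) ->
  theta s0 = 0 -> u s0 = r -> v s0 = 0 ->
  forall s, in_itv a b s ->
    u s = r * cos (w * theta s) /\ v s = r * sin (w * theta s).
Proof.
  intros Hs0 Htheta Hu Hv Htheta0 Hu0 Hv0 s Hs.
  assert (HP : u s * cos (w * theta s) + v s * sin (w * theta s) = r).
  { rewrite (derive_zero_constant a b
      (fun s => u s * cos (w * theta s) + v s * sin (w * theta s))) with (t := s0); auto.
    - rewrite Htheta0, Hu0, Hv0, Rmult_0_r, cos_0; ring.
    - intros t Ht.
      specialize (Htheta t Ht); specialize (Hu t Ht); specialize (Hv t Ht).
      auto_derive; [repeat split; eexists; eassumption |].
      rewrite (is_derive_unique _ _ _ Hu
            : Derive (fun x : R => u x) t = _), (is_derive_unique _ _ _ Hv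
            : Derive (fun x : R => v x) t = _),
          (is_derive_unique _ _ _ Htheta
            : Derive (fun x : R => theta x) t = _); ring. }
  assert (HQ : v s * cos (w * theta s) - u s * sin (w * theta s) = 0).
  { rewrite (derive_zero_constant a b
      (fun s => v s * cos (w * theta s) - u s * sin (w * theta s))) with (t := s0); auto.
    - rewrite Htheta0, Hv0, Rmult_0_r, sin_0; ring.
    - intros t Ht.
      specialize (Htheta t Ht); specialize (Hu t Ht); specialize (Hv t Ht).
      auto_derive; [repeat split; eexists; eassumption |].
      rewrite (is_derive_unique _ _ _ Hu
            : Derive (fun x : R => u x) t = _), (is_derive_unique _ _ _ Hv
            : Derive (fun x : R => v x) t = _),
          (is_derive_unique _ _ _ Htheta
            : Derive (fun x : R => theta x) t = _); ring. }
  pose proof (sin2_cos2 (w * theta s)) as Hsc; unfold Rsqr in Hsc.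
  set (C := cos (w * theta s)) in *; set (S := sin (w * theta s)) in *.
  split.
  - transitivity (u s * (S * S + C * C)); [rewrite Hsc; ring |].
    rewrite <- HP; transitivity ((u s * C + v s * S) * C
      - S * (v s * C - u s * S)); [ring | rewrite HQ; ring].
  - transitivity (v s * (S * S + C * C)); [rewrite Hsc; ring |].
    rewrite <- HP; transitivity ((u s * C + v s * S) * S
      + C * (v s * C - u s * S)); [ring | rewrite HQ; ring].
Qed.

(** The unit vector [(p, q)] is orthogonal to [(u, v)], hence it is [(u, v)]
    turned by a right angle and divided by [r], up to a sign. That sign is the one of
    [u q - v p], whose square is [r ^ 2] by Lagrange's identity; so it keeps its
    initial value, and the velocity equation becomes that of a rotation. *)
Lemma circle_motion (a b : Rbar) (theta k u v p q dp dq : R -> R) (r s0 : R) :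
  0 < r -> in_itv a b s0 ->
  (forall s, in_itv a b s -> is_derive theta s (k s)) ->
  (forall s, in_itv a b s -> is_derive u s (k s * p s)) ->
  (forall s, in_itv a b s -> is_derive v s (k s * q s)) ->
  (forall s, in_itv a b s -> is_derive p s (dp s)) ->
  (forall s, in_itv a b s -> is_derive q s (dq s)) ->
  (forall s, in_itv a b s -> u s * u s + v s * v s = r * r) ->
  (forall s, in_itv a b s -> p s * p s + q s * q s = 1) ->
  (forall s, in_itv a b s -> u s * p s + v s * q s = 0) ->
  theta s0 = 0 -> u s0 = r -> v s0 = 0 -> q s0 = 1 ->
  forall s, in_itv a b s ->
    u s = r * cos (/ r * theta s) /\ v s = r * sin (/ r * theta s).
Proof.
  intros Hr Hs0 Htheta Hu Hv Hp Hq Huv Hpq Horth Htheta0 Hu0 Hv0 Hq0.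
  assert (Hdelta : forall s, in_itv a b s -> is_derive (fun t => u t * q t - v t * p t) s
            (k s * p s * q s + u s * dq s - (k s * q s * p s + v s * dp s))).
  { intros s Hs.
    specialize (Hu s Hs); specialize (Hv s Hs); specialize (Hp s Hs); specialize (Hq s Hs).
    auto_derive; [repeat split; eexists; eassumption |].
    rewrite (is_derive_unique _ _ _ Hu
            : Derive (fun x : R => u x) s = _), (is_derive_unique _ _ _ Hv
            : Derive (fun x : R => v x) s = _),
        (is_derive_unique _ _ _ Hp
            : Derive (fun x : R => p x) s = _), (is_derive_unique _ _ _ Hq
            : Derive (fun x : R => q x) s = _); ring. }
  assert (Hlagrange : forall s, in_itv a b s ->
            (u s * q s - v s * p s) * (u s * q s - v s * p s) = r * r).
  { intros s Hs.
    transitivity ((u s * u s + v s * v s) * (p s * p s + q s * q s)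
                  - (u s * p s + v s * q s) * (u s * p s + v s * q s)); [ring |].
    rewrite Huv, Hpq, Horth; auto; ring. }
  assert (Hor : forall s, in_itv a b s -> u s * q s - v s * p s = r).
  { intros s Hs.
    rewrite (derive_zero_constant a b (fun t => u t * q t - v t * p t)) with (t := s0); auto.
    - rewrite Hu0, Hv0, Hq0; ring.
    - intros t Ht.
      rewrite <- (derive_zero_of_constant_square a b _ _ _ Hdelta Hlagrange t Ht); auto. }
  assert (Hturn : forall s, in_itv a b s -> p s = - (/ r * v s) /\ q s = / r * u s).
  { intros s Hs.
    specialize (Huv s Hs); specialize (Hor s Hs); specialize (Horth s Hs).
    split; apply (Rmult_eq_reg_l (r * r)); try nra.
    - transitivity (- (r * v s)); [| field; lra].
      rewrite <- Huv.
      transitivity (u s * (u s * p s + v s * q s) - v s * (u s * q s - v s * p s)); [ring |].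
      rewrite Horth, Hor; ring.
    - transitivity (r * u s); [| field; lra].
      rewrite <- Huv.
      transitivity (v s * (u s * p s + v s * q s) + u s * (u s * q s - v s * p s)); [ring |].
      rewrite Horth, Hor; ring. }
  apply (rotation_solution a b theta k) with (s0 := s0); auto.
  - intros s Hs; destruct (Hturn s Hs) as [H _].
    replace (- (/ r * k s * v s)) with (k s * p s) by (rewrite H; ring); auto.
  - intros s Hs; destruct (Hturn s Hs) as [_ H].
    replace (/ r * k s * u s) with (k s * q s) by (rewrite H; ring); auto.
Qed.

(** * Helices with a timelike axis *)

(** The components [kappa N_i] of [psi''] are continuous, and pairing [psi'']
    with the unit vector [N] recovers [kappa]. *)
Lemma frenet_curvature_continuous (a b : Rbar) (psi T N B : R -> E13)
    (kappa tau : R -> R) :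
  smooth_curve a b psi -> frenet_frame a b psi T N B kappa tau 1 ->
  forall s, in_itv a b s -> continuous kappa s.
Proof.
  intros Hsmooth HF.
  assert (coordinate : forall l : E13 -> R, is_linear l ->
            (forall s, in_itv a b s -> ex_derive_n (fun u => l (psi u)) 3 s) ->
            forall s, in_itv a b s -> continuous (fun u => kappa u * l (N u) * l (N u)) s).
  { intros l Hl H3 s Hs.
    apply (continuous_mult (K := R_AbsRing) (fun u => kappa u * l (N u)) (fun u => l (N u))).
    - apply (continuous_second_derivative a b (fun u => l (psi u)) (fun u => l (T u)));
        auto.
      + intros u Hu.
        exact (is_derive_linear l psi u _ Hl (frenet_T _ _ _ _ _ _ _ _ _ HF u Hu)).
      + intros u Hu.
        pose proof (is_derive_linear l T u _ Hl (frenet_dT _ _ _ _ _ _ _ _ _ HF u Hu)) as H.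
        rewrite (linear_scal l Hl) in H; exact H.
    - exact (continuous_linear_of_is_derive l N s _ Hl (frenet_dN _ _ _ _ _ _ _ _ _ HF s Hs)). }
  intros s Hs.
  apply (continuous_ext_loc _ (fun u => kappa u * x2 (N u) * x2 (N u)
           + kappa u * x3 (N u) * x3 (N u) - kappa u * x1 (N u) * x1 (N u))).
  - apply filter_imp with (2 := in_itv_locally a b s Hs).
    intros u Hu.
    pose proof (frenet_gNN _ _ _ _ _ _ _ _ _ HF u Hu) as H; unfold g in H.
    rewrite <- (Rmult_1_r (kappa u)) at 4; rewrite <- H.
    match goal with |- ?x = ?y => change (@eq R x y) end; ring.
  - apply (continuous_minus (V := R_NormedModule)).
    + apply (continuous_plus (V := R_NormedModule)).
      * apply (coordinate x2 is_linear_x2); [intros; now apply Hsmooth | exact Hs].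
      * apply (coordinate x3 is_linear_x3); [intros; now apply Hsmooth | exact Hs].
    + apply (coordinate x1 is_linear_x1); [intros; now apply Hsmooth | exact Hs].
Qed.

Lemma frenet_spacelike_normal (a b : Rbar) (psi T N B : R -> E13)
    (kappa tau : R -> R) (eps s : R) :
  frenet_frame a b psi T N B kappa tau eps -> in_itv a b s -> spacelike (N s) -> eps = 1.
Proof.
  intros HF Hs HN.
  pose proof (frenet_gNN _ _ _ _ _ _ _ _ _ HF s Hs) as HNN.
  destruct (frenet_eps _ _ _ _ _ _ _ _ _ HF) as [H | H]; [exact H | exfalso].
  destruct HN as [HN | HN].
  - lra.
  - rewrite HN in HNN; unfold g, x1, x2, x3 in HNN; simpl in HNN; lra.
Qed.

Lemma is_derive_g_tangent (a b : Rbar) (psi T N B : R -> E13) (kappa tau : R -> R)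
    (eps : R) (w : E13) :
  frenet_frame a b psi T N B kappa tau eps ->
  forall s, in_itv a b s -> is_derive (fun u => g (T u) w) s (kappa s * g (N s) w).
Proof.
  intros HF s Hs; rewrite <- g_scal.
  apply (is_derive_linear (fun v => g v w) T); [apply is_linear_g |].
  exact (frenet_dT _ _ _ _ _ _ _ _ _ HF s Hs).
Qed.

(** The direction vector of the axis is normalised up to sign: the angle
    determines only the absolute value of [g (T, d)], and the sign of [k] is chosen
    so that the tangent has first coordinate [+ sinh phi] in a frame starting with
    [scal k d]. Orthogonality of the normal to the axis is where the curvature has
    to be nonzero. *)
Lemma helix_axis (a b : Rbar) (psi T N B : R -> E13) (kappa tau : R -> R) (eps : R)
    (d : E13) (phi s0 : R) :
  in_itv a b s0 ->
  frenet_frame a b psi T N B kappa tau eps ->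
  (forall s, in_itv a b s -> kappa s <> 0) ->
  timelike d ->
  (forall s, in_itv a b s -> timelike_angle (T s) d phi) ->
  exists k : R, k <> 0 /\ g (scal k d) (scal k d) = -1 /\
    forall s, in_itv a b s ->
      g (T s) (scal k d) = - sinh phi /\ g (N s) (scal k d) = 0.
Proof.
  intros Hs0 HF Hkappa Hd Hangle.
  set (l := lnorm d).
  assert (Hl2 : l * l = - g d d).
  { unfold l, lnorm; rewrite sqrt_sqrt by apply Rabs_pos.
    apply Rabs_left; exact Hd. }
  assert (Hl : 0 < l).
  { unfold l, lnorm; apply sqrt_lt_R0, Rabs_pos_lt; unfold timelike in Hd; lra. }
  assert (Habs : forall s, in_itv a b s -> Rabs (g (T s) d) = l * sinh phi).
  { intros s Hs; destruct (Hangle s Hs) as [_ H]; rewrite H; fold l.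
    unfold lnorm; rewrite (frenet_gTT _ _ _ _ _ _ _ _ _ HF s Hs), Rabs_R1, sqrt_1; ring. }
  pose proof (is_derive_g_tangent _ _ _ _ _ _ _ _ _ d HF) as Hderiv.
  assert (HNd : forall s, in_itv a b s -> g (N s) d = 0).
  { intros s Hs.
    apply (Rmult_eq_reg_l (kappa s)); [rewrite Rmult_0_r | auto].
    apply (derive_zero_of_constant_square a b _ _ ((l * sinh phi) * (l * sinh phi)) Hderiv);
      [| exact Hs].
    intros u Hu; rewrite <- (Habs u Hu), <- Rabs_mult.
    symmetry; apply Rabs_pos_eq, Rle_0_sqr. }
  assert (HTd : forall s, in_itv a b s -> g (T s) d = g (T s0) d).
  { intros s Hs.
    apply (derive_zero_constant a b (fun u => g (T u) d)); auto.
    intros u Hu; pose proof (Hderiv u Hu) as H.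
    rewrite (HNd u Hu), Rmult_0_r in H; exact H. }
  assert (exists e, e * e = 1 /\ e * g (T s0) d = - (l * sinh phi)) as (e & Hee & HeT).
  { pose proof (Habs s0 Hs0) as H; unfold Rabs in H.
    destruct (Rcase_abs (g (T s0) d)).
    - exists 1; split; lra.
    - exists (-1); split; lra. }
  exists (e / l).
  assert (Hg : forall v, g v (scal (e / l) d) = e / l * g v d).
  { intro v; rewrite g_sym, g_scal, g_sym; reflexivity. }
  split; [| split].
  - intro H; assert (e = 0) by (replace e with (e / l * l) by (field; lra); rewrite H; ring).
    subst; lra.
  - rewrite Hg, g_scal.
    replace (g d d) with (- (l * l)) by lra.
    transitivity (- (e * e)); [field; lra | lra].
  - intros s Hs; rewrite !Hg, (HNd s Hs), (HTd s Hs); split; [| ring].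
    replace (e / l * g (T s0) d) with (e * g (T s0) d / l) by (field; lra).
    rewrite HeT; field; lra.
Qed.

(** The Gram-Schmidt vector of [T0] with respect to [A] is [T0 - n A], of square
    [1 + n ^ 2]. *)
Lemma tangent_lorentz_frame (A T0 N0 : E13) (n r : R) :
  0 < r -> r * r = 1 + n * n ->
  g A A = -1 -> g T0 T0 = 1 -> g N0 N0 = 1 -> g T0 N0 = 0 ->
  g T0 A = - n -> g N0 A = 0 ->
  let E := scal (/ r) (plus T0 (scal (- n) A)) in
  lorentz_frame A E N0 /\ g T0 E = r.
Proof.
  intros Hr Hr2 HAA HTT HNN HTN HTA HNA E.
  assert (HE : forall v, g v E = / r * (g v T0 - n * g v A)).
  { intro v; unfold E; rewrite g_sym, g_scal, g_plus, g_scal, (g_sym T0), (g_sym A); ring. }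
  assert (HTE : g T0 E = r).
  { rewrite HE, HTT, HTA; transitivity (/ r * (r * r)); [rewrite Hr2; ring | field; lra]. }
  assert (HAE : g A E = 0) by (rewrite HE, (g_sym A T0), HTA, HAA; ring).
  split; [split | exact HTE]; auto.
  - rewrite HE, !(g_sym E), HTE, HAE; field; lra.
  - now rewrite g_sym.
  - rewrite g_sym, HE, (g_sym N0 T0), HTN, HNA; ring.
Qed.

Theorem theorem3p7
  (a b : Rbar) (hab : Rbar_lt a b)
  (psi T N B : R -> E13) (kappa tau : R -> R) (eps : R)
  (hsmooth : smooth_curve a b psi)
  (hunit : unit_speed_spacelike a b psi)
  (hfrenet : frenet_frame a b psi T N B kappa tau eps)
  (hkappa : forall s, in_itv a b s -> kappa s <> 0)
  (hN : forall s, in_itv a b s -> spacelike (N s))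
  (p d : E13) (hd : positive_timelike d)
  (phi : R)
  (hhelix : forall s, in_itv a b s -> timelike_angle (T s) d phi)
  (n m : R) (hn : n = sinh phi) (hm : m = n / sqrt (1 + n ^ 2)) :
  exists F : E13 -> E13,
    isometry F /\ carries_line_to_direction F p d e1 /\
    exists theta : R -> R,
      indefinite_integral a b kappa theta /\
      (exists Psi : R -> E13,
         indefinite_integral a b (fun s => helix_direction m (theta s)) Psi /\
         forall s, in_itv a b s ->
           F (psi s) = scal (sqrt (n ^ 2 + 1)) (Psi s)) /\
      (exists (c c' : Rbar) (sigma : R -> R),
         inverse_parameter a b c c' theta sigma /\
         indefinite_integral c c'
           (fun t => scal (sqrt (n ^ 2 + 1) / kappa (sigma t))
                       (helix_direction m t))
           (fun t => F (psi (sigma t)))).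
Proof.
  destruct (in_itv_inhabited a b hab) as [s0 Hs0].
  assert (Heps : eps = 1).
  { exact (frenet_spacelike_normal _ _ _ _ _ _ _ _ _ s0 hfrenet Hs0 (hN s0 Hs0)). }
  subst eps.
  pose proof (frenet_curvature_continuous _ _ _ _ _ _ _ _ hsmooth hfrenet) as Hkc.
  destruct (helix_axis _ _ _ _ _ _ _ _ _ d phi s0 Hs0 hfrenet hkappa (proj1 hd) hhelix)
    as (k & Hk & HAA & HA).
  rewrite <- hn in HA.
  set (A := scal k d : E13) in *.
  replace (n ^ 2 + 1) with (1 + n ^ 2) by ring.
  set (r := sqrt (1 + n ^ 2)) in *.
  assert (Hr : 0 < r) by (apply sqrt_lt_R0; nra).
  assert (Hr2 : r * r = 1 + n * n).
  { unfold r; rewrite sqrt_sqrt by nra; ring. }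
  assert (Hw : sqrt (1 - m ^ 2) = / r).
  { replace (1 - m ^ 2) with (/ r * / r).
    - apply sqrt_square, Rlt_le, Rinv_0_lt_compat, Hr.
    - rewrite hm; apply (Rmult_eq_reg_l (r * r)); [| nra].
      replace (r * r * (/ r * / r)) with 1 by (field; lra).
      replace (r * r * (1 - (n / r) ^ 2)) with (r * r - n * n) by (field; lra).
      lra. }
  destruct (tangent_lorentz_frame A (T s0) (N s0) n r) as [Hframe HTE];
    try apply HA; try apply hfrenet; auto.
  set (E := scal (/ r) (plus (T s0) (scal (- n) A)) : E13) in *.
  set (L := frame_coordinates A E (N s0)).
  assert (HL : is_linear L) by apply is_linear_frame_coordinates.
  exists L; split; [| split].
  { apply isometry_of_linear; [exact HL |].
    intros v w; apply g_frame_coordinates, Hframe. }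
  { apply (linear_carries_line_to_direction L p d e1 k HL Hk).
    change (L A = e1); unfold L, frame_coordinates, e1.
    destruct Hframe as [_ _ _ HAE HAM _]; rewrite HAA, HAE, HAM.
    now replace (- -1) with 1 by ring. }
  destruct (antiderivative_vanishing_at a b kappa s0 Hs0 Hkc) as (theta & Htheta0 & Htheta).
  assert (HgL : forall v w, - (g v A * g w A) + g v E * g w E + g v (N s0) * g w (N s0)
                            = g v w).
  { intros v w; rewrite <- (g_frame_coordinates A E (N s0) v w Hframe).
    unfold g at 7, frame_coordinates, x1, x2, x3; simpl; ring. }
  assert (HT : forall s, in_itv a b s -> L (T s) = scal r (helix_direction m (theta s))).
  { intros s Hs.
    destruct (circle_motion a b theta kappa
                (fun s => g (T s) E) (fun s => g (T s) (N s0))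
                (fun s => g (N s) E) (fun s => g (N s) (N s0))
                (fun s => g (plus (scal (- 1 * kappa s) (T s)) (scal (tau s) (B s))) E)
                (fun s => g (plus (scal (- 1 * kappa s) (T s)) (scal (tau s) (B s))) (N s0))
                r s0) with (s := s) as [Hcos Hsin]; auto.
    - intros u Hu; apply (is_derive_g_tangent _ _ _ _ _ _ _ _ _ E hfrenet u Hu).
    - intros u Hu; apply (is_derive_g_tangent _ _ _ _ _ _ _ _ _ (N s0) hfrenet u Hu).
    - intros u Hu.
      exact (is_derive_linear (fun v => g v E) N u _ (is_linear_g E)
               (frenet_dN _ _ _ _ _ _ _ _ _ hfrenet u Hu)).
    - intros u Hu.
      exact (is_derive_linear (fun v => g v (N s0)) N u _ (is_linear_g (N s0))
               (frenet_dN _ _ _ _ _ _ _ _ _ hfrenet u Hu)).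
    - intros u Hu; pose proof (HgL (T u) (T u)) as H.
      rewrite (proj1 (HA u Hu)), (frenet_gTT _ _ _ _ _ _ _ _ _ hfrenet u Hu) in H; lra.
    - intros u Hu; pose proof (HgL (N u) (N u)) as H.
      rewrite (proj2 (HA u Hu)), (frenet_gNN _ _ _ _ _ _ _ _ _ hfrenet u Hu) in H; lra.
    - intros u Hu; pose proof (HgL (T u) (N u)) as H.
      rewrite (proj2 (HA u Hu)), (frenet_gTN _ _ _ _ _ _ _ _ _ hfrenet u Hu) in H; lra.
    - apply (frenet_gTN _ _ _ _ _ _ _ _ _ hfrenet s0 Hs0).
    - apply (frenet_gNN _ _ _ _ _ _ _ _ _ hfrenet s0 Hs0).
    - unfold L, frame_coordinates, helix_direction; rewrite Hw.
      rewrite (proj1 (HA s Hs)), Hcos, Hsin, hm.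
      change ((- - n, r * cos (/ r * theta s), r * sin (/ r * theta s))
              = (r * (n / r), r * cos (/ r * theta s), r * sin (/ r * theta s))).
      f_equal; f_equal; field; lra. }
  assert (HLpsi : forall s, in_itv a b s -> is_derive (fun u => L (psi u)) s (L (T s))).
  { intros s Hs.
    exact (is_derive_linear L psi s _ HL (frenet_T _ _ _ _ _ _ _ _ _ hfrenet s Hs)). }
  assert (HLT : forall s, in_itv a b s -> continuous (fun u => L (T u)) s).
  { intros s Hs.
    exact (continuous_linear_of_is_derive L T s _ HL
             (frenet_dT _ _ _ _ _ _ _ _ _ hfrenet s Hs)). }
  exists theta; split; [now apply indefinite_integral_of_derive |]; split.
  - exists (fun s => scal (/ r) (L (psi s))); split.
    + apply (indefinite_integral_ext a b (fun s => scal (/ r) (L (T s)))).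
      { intros s Hs; rewrite (HT s Hs), scal_assoc.
        replace (mult (/ r) r) with (one : R).
        - apply (scal_one (helix_direction m (theta s))).
        - unfold mult, one; simpl; field; lra. }
      apply indefinite_integral_curve_of_derive; intros s Hs.
      * exact (is_derive_linear _ (fun u => L (psi u)) s _
                 (is_linear_scal_r (/ r) Rmult_comm) (HLpsi s Hs)).
      * apply (continuous_scal_r (/ r) (fun u => L (T u))); auto.
    + intros s Hs; rewrite scal_assoc.
      replace (mult r (/ r)) with (one : R).
      * symmetry; apply (scal_one (L (psi s))).
      * unfold mult, one; simpl; field; lra.
  - destruct (differentiable_inverse_parameter a b theta kappa hab Htheta Hkc hkappa)
      as (c & c' & sigma & Hinv & Hsigma).
    exists c, c', sigma; split; [exact Hinv |].
    apply (indefinite_integral_ext c c'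
             (fun t => scal (/ kappa (sigma t)) (L (T (sigma t))))).
    { intros t Ht; destruct (proj2 Hinv t Ht) as [Hs Hst].
      rewrite (HT _ Hs), Hst, scal_assoc; f_equal.
      unfold mult; simpl; unfold Rdiv; ring. }
    apply indefinite_integral_curve_of_derive; intros t Ht;
      destruct (proj2 Hinv t Ht) as [Hs _].
    + apply (is_derive_comp (fun s => L (psi s)) sigma); auto.
    + assert (Hsc : continuous sigma t).
      { apply (ex_derive_continuous (V := R_NormedModule)).
        eexists; apply Hsigma; exact Ht. }
      apply (continuous_scal (fun t => / kappa (sigma t)) (fun t => L (T (sigma t)))).
      * apply (continuous_comp sigma (fun s => / kappa s)); [exact Hsc |].
        apply continuity_pt_filterlim, continuity_pt_inv; [| auto].
        apply continuity_pt_filterlim; exact (Hkc _ Hs).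
      * exact (continuous_comp sigma (fun s => L (T s)) t Hsc (HLT _ Hs)).
Qed.
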